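(* For all integers $k\ge2$ and $n\ge1$, the projection constant of $\operatorname{Lip}_0(D_{n,k})$, where $D_{n,k}$ is the diamond graph of branching $k$, is $$\lambda(\operatorname{Lip}_0(D_{n,k}))=\frac{2k-2}{2k-1}\,n+\frac{4k^2-6k+3}{(2k-1)^2}+\frac{2k-2}{(2k-1)^2}\cdot\frac{1}{(2k)^n}.$$ In particular, for $k=2$ (with $D_n=D_{n,2}$) and $n\ge1$, $$\lambda(\operatorname{Lip}_0(D_n))=\frac{2n}{3}+\frac79+\frac29\,4^{-n}.$$
   Context: Diamond graphs of branching $k$: $D_{0,k}$ is the graph with two vertices joined by one edge. For $n\ge1$, $D_{n,k}$ is obtained from $D_{n-1,k}$ by replacing each edge $uv$ by a set of $k$ independent (internally disjoint) paths of length $2$ joining $u$ and $v$. The vertex set of $D_{n,k}$ is given the (unweighted) shortest path metric. $D_n$ denotes $D_{n,2}$. For a metric space $X$ with a base point $O$, $\operatorname{Lip}_0(X)$ is the Banach space of Lipschitz functions $f:X\to\mathbb{R}$ with $f(O)=0$, normed by the Lipschitz constant of $f$ (up to isometry it does not depend on $O$). Projection constant: for a finite-dimensional normed space $X$, let $X_1$ be any subspace of $\ell_\infty$ isometrically isomorphic to $X$; then $\lambda(X)=\inf\{\|P\| : P:\ell_\infty\to\ell_\infty \text{ is a (bounded linear) projection with range } X_1\}$, which does not depend on the choice of $X_1$. *)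

(* Defs.v *)
From HB Require Import structures.
From mathcomp Require Import all_boot all_order all_algebra.
From mathcomp Require Import all_classical all_reals ereal topology normedtype.

Set Implicit Arguments.
Unset Strict Implicit.
Unset Printing Implicit Defensive.

Import Order.TTheory GRing.Theory Num.Theory.
Import numFieldNormedType.Exports.

Local Open Scope classical_set_scope.
Local Open Scope ring_scope.

(* Finite undirected graphs. The orientation given by [src] and [tgt] only
   names the two endpoints of an edge: [adj] forgets it. *)
Record graph := Graph {
  vertex :> finType ;
  edge : finType ;
  src : edge -> vertex ;
  tgt : edge -> vertex
}.

Section graph_distance.
Variable G : graph.
Implicit Types (x y z : G) (l m : nat).

Definition adj : rel G := fun x y =>
  [exists e : edge G, ((src e == x) && (tgt e == y))
                      || ((src e == y) && (tgt e == x))].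

Definition walk l x y : bool :=
  [exists p : l.-tuple G, path adj x p && (last x p == y)].

(* The least length of a walk from [x] to [y]. A shortest walk has fewer than
   #|G| edges, so that the value is exact as soon as [x] and [y] are connected
   (see [gdistP]); it is #|G|, by convention, when they are not. *)
Definition gdist x y : nat := find (fun l => walk l x y) (iota 0 #|G|).

Lemma adj_sym : symmetric adj.
Proof.
by move=> x y; apply/existsP/existsP => -[e he]; exists e; rewrite orbC.
Qed.

Lemma walkP l x y :
  reflect (exists p : seq G, [/\ size p = l, path adj x p & last x p = y])
          (walk l x y).
Proof.
apply: (iffP existsP) => [[p /andP[hp /eqP hl]]|[p [hs hp hl]]].
  by exists p; split=> //; rewrite size_tuple.
move/eqP in hs; exists (Tuple hs) => /=; by rewrite hp hl eqxx.
Qed.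

Lemma walk0 x y : walk 0 x y = (x == y).
Proof.
apply/walkP/eqP => [[p [/size0nil -> _ <-]]|->]; by [|exists [::]].
Qed.

Lemma walk_cat l m x y z : walk l x y -> walk m y z -> walk (l + m) x z.
Proof.
move=> /walkP[p [<- hp <-]] /walkP[q [<- hq <-]].
by apply/walkP; exists (p ++ q); rewrite size_cat cat_path last_cat hp hq.
Qed.

Lemma walk_sym l x y : walk l x y = walk l y x.
Proof.
have sub u v : walk l u v -> walk l v u.
  move=> /walkP[p [<- hp <-]]; apply/walkP; exists (rev (belast u p)); split.
  - by rewrite size_rev size_belast.
  - by rewrite rev_path; under eq_path do rewrite -/(adj _ _) adj_sym.
  - by case: p {hp} => //= a p; rewrite rev_cons last_rcons.
by apply/idP/idP; exact: sub.
Qed.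

Lemma gdist_max x y : (gdist x y <= #|G|)%N.
Proof. by rewrite -[X in (_ <= X)%N](size_iota 0) find_size. Qed.

Lemma gdist_le l x y : walk l x y -> (gdist x y <= l)%N.
Proof.
move=> w; rewrite leqNgt; apply/negP => hl.
have := before_find 0%N hl.
by rewrite nth_iota ?add0n ?w// (leq_trans hl)// gdist_max.
Qed.

Lemma gdist_walk x y : (gdist x y < #|G|)%N -> walk (gdist x y) x y.
Proof.
move=> h; have hs : has (fun l => walk l x y) (iota 0 #|G|).
  by rewrite has_find size_iota.
by have := nth_find 0%N hs; rewrite nth_iota.
Qed.

Lemma gdistP x y : (exists l, walk l x y) ->
  walk (gdist x y) x y /\ forall l, walk l x y -> (gdist x y <= l)%N.
Proof.
move=> [l /walkP[p [_ hp hl]]]; split=> [|m]; last exact: gdist_le.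
apply: gdist_walk; case/shortenP: hp hl => q hq uq _ hl.
have wq : walk (size q) x y by apply/walkP; exists q.
by apply: leq_ltn_trans (gdist_le wq) _; have := max_card (mem (x :: q));
  rewrite (card_uniqP uq).
Qed.

Lemma gdistxx x : gdist x x = 0%N.
Proof. by apply/eqP; rewrite -leqn0 gdist_le// walk0. Qed.

Lemma gdist_eq0 x y : gdist x y = 0%N -> x = y.
Proof.
move=> h; have : walk 0 x y.
  by rewrite -h gdist_walk// h; apply/card_gt0P; exists x.
by rewrite walk0 => /eqP.
Qed.

Lemma gdist_sym x y : gdist x y = gdist y x.
Proof. by apply: eq_find => l; exact: walk_sym. Qed.

Lemma gdist_triangle y x z : (gdist x z <= gdist x y + gdist y z)%N.
Proof.
have [hxy|hxy] := ltnP (gdist x y) #|G|; last first.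
  exact: leq_trans (gdist_max x z) (leq_trans hxy (leq_addr _ _)).
have [hyz|hyz] := ltnP (gdist y z) #|G|; last first.
  exact: leq_trans (gdist_max x z) (leq_trans hyz (leq_addl _ _)).
exact: gdist_le (walk_cat (gdist_walk hxy) (gdist_walk hyz)).
Qed.

End graph_distance.

(* The vertex set of [G] with the shortest path metric. *)
Definition graph_space (R : realType) (G : graph) : Type := G.

Section graph_space_metric.
Variables (R : realType) (G : graph).
Local Notation T := (graph_space R G).

HB.instance Definition _ := Finite.copy T (vertex G).

Let d (x y : T) : R := (@gdist G x y)%:R.

Let dxx x : d x x = 0. Proof. by rewrite /d gdistxx. Qed.

Let d_eq0 x y : d x y = 0 -> x = y.
Proof. by move/eqP; rewrite pnatr_eq0 => /eqP /gdist_eq0. Qed.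

Let d_sym x y : d x y = d y x. Proof. by rewrite /d gdist_sym. Qed.

Let d_triangle y x z : d x z <= d x y + d y z.
Proof. by rewrite /d -natrD ler_nat gdist_triangle. Qed.

HB.instance Definition _ := isMetric.Build R T dxx d_eq0 d_sym d_triangle.

End graph_space_metric.

Lemma graph_space_mdistE (R : realType) (G : graph) (x y : graph_space R G) :
  mdist x y = (@gdist G x y)%:R.
Proof. by []. Qed.

(* Each edge [e] is replaced by the [k] paths src e -- (e, i) -- tgt e. *)
Definition replace_edges (k : nat) (G : graph) : graph :=
  @Graph (G + edge G * 'I_k)%type (edge G * 'I_k * bool)%type
    (fun a => if a.2 then inr a.1 else inl (src a.1.1))
    (fun a => if a.2 then inl (tgt a.1.1) else inr a.1).

Definition single_edge : graph :=
  @Graph bool unit (fun=> false) (fun=> true).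

Definition diamond (n k : nat) : graph := iter n (replace_edges k) single_edge.

Lemma diamond_connected n k (x y : diamond n k) : (0 < k)%N ->
  exists l, walk l x y.
Proof.
move=> k0; elim: n x y => [|n IH].
  have w01 : walk 1 (false : single_edge) true.
    by apply/walkP; exists [:: true]; split=> //=; rewrite andbT;
       apply/existsP; exists tt.
  case; case; do ?[by exists 0%N; rewrite walk0];
    by exists 1%N => //; rewrite walk_sym.
rewrite [diamond n.+1 k]/(replace_edges k (diamond n k)).
set G := diamond n k in IH *; set H := replace_edges k G.
have half (e : edge G) i : walk 1 (inl (src e) : H) (inr (e, i)).
  by apply/walkP; exists [:: inr (e, i)]; split=> //=; rewrite andbT;
     apply/existsP; exists (e, i, false); rewrite /= !eqxx.
have half' (e : edge G) i : walk 1 (inr (e, i) : H) (inl (tgt e)).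
  by apply/walkP; exists [:: inl (tgt e)]; split=> //=; rewrite andbT;
     apply/existsP; exists (e, i, true); rewrite /= !eqxx.
have step (u v : G) : adj u v -> walk 2 (inl u : H) (inl v).
  have two e : walk 2 (inl (src e) : H) (inl (tgt e)).
    exact: walk_cat (half e (Ordinal k0)) (half' e (Ordinal k0)).
  case/existsP => e /orP[]/andP[/eqP <- /eqP <-] //; by rewrite walk_sym.
have old (u v : G) : exists l, walk l (inl u : H) (inl v).
  have [l /walkP[p [_ hp <-]]] := IH u v.
  elim: p u hp => [|w p IHp] u /=; first by exists 0%N; rewrite walk0.
  by case/andP=> /step uw /IHp[m wv]; exists (2 + m)%N; exact: walk_cat uw wv.
have to_old (a : H) : exists l (u : G), walk l a (inl u).
  case: a => [u|[e i]]; first by exists 0%N, u; rewrite walk0.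
  by exists 1%N, (tgt e); exact: half'.
move=> x y; have [l [u xu]] := to_old x; have [m [v yv]] := to_old y.
have [q uv] := old u v; exists (l + (q + m))%N.
by apply: walk_cat xu (walk_cat uv _); rewrite walk_sym.
Qed.

Section Lip0.
Variables (R : realType) (X : metricType R) (O : X).

Definition lipschitz_with (L : R) (f : X -> R) : Prop :=
  forall x y, `|f x - f y| <= L * mdist x y.

Definition Lip0_pred : {pred X -> R} :=
  mem [set f | f O = 0 /\ exists L, lipschitz_with L f].

Record Lip0 := MkLip0 {
  Lip0_fun :> X -> R ;
  Lip0_funP : Lip0_fun \in Lip0_pred
}.

HB.instance Definition _ := [isSub for Lip0_fun].
HB.instance Definition _ := [Choice of Lip0 by <:].

Lemma Lip0_submod_closed : submod_closed Lip0_pred.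
Proof.
split=> [|a f g]; rewrite !inE /=.
  split=> //; exists 0 => x y; by rewrite mul0r subrr normr0.
move=> [f0 [L hL]] [g0 [M hM]].
split; first by rewrite !fctE f0 g0 scaler0 addr0.
exists (`|a| * L + M) => x y.
have -> : (a *: f + g) x - (a *: f + g) y = a * (f x - f y) + (g x - g y).
  by rewrite !fctE /GRing.scale /= mulrBr opprD addrACA.
rewrite (le_trans (ler_normD _ _))// mulrDl lerD// normrM -mulrA.
exact: ler_wpM2l.
Qed.

HB.instance Definition _ :=
  GRing.isSubmodClosed.Build _ _ Lip0_pred Lip0_submod_closed.
HB.instance Definition _ := [SubChoice_isSubLmodule of Lip0 by <:].

(* The condition 0 <= L matters only when [X] is a single point. *)
Definition Lip0_norm (f : Lip0) : R :=
  inf [set L | 0 <= L /\ lipschitz_with L f].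

Implicit Types (f g : Lip0) (L : R).

Let S f : set R := [set L | 0 <= L /\ lipschitz_with L f].

Let S_lb f : lbound (S f) 0. Proof. by move=> L []. Qed.

Let S_neq0 f : S f !=set0.
Proof.
have := Lip0_funP f; rewrite inE /= => -[_ [L hL]].
exists `|L|; split=> // x y; rewrite (le_trans (hL x y))//.
by rewrite ler_wpM2r ?mdist_ge0// ler_norm.
Qed.

Lemma Lip0_norm_ge0 f : 0 <= Lip0_norm f.
Proof. exact: lb_le_inf (S_neq0 f) (@S_lb f). Qed.

Lemma Lip0_norm_le f L : 0 <= L -> lipschitz_with L f -> Lip0_norm f <= L.
Proof. by move=> L0 hL; apply: ge_inf; [exists 0; exact: S_lb | split]. Qed.

Lemma Lip0_normP f : lipschitz_with (Lip0_norm f) f.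
Proof.
move=> x y; have [->|xy] := eqVneq x y.
  by rewrite subrr normr0 mulr_ge0 ?mdist_ge0 ?Lip0_norm_ge0.
have d0 : 0 < mdist x y by rewrite mdist_gt0.
rewrite -ler_pdivrMr//; apply: lb_le_inf (S_neq0 f) _ => L [_ hL].
by rewrite ler_pdivrMr.
Qed.

Let norm_triangle f g : Lip0_norm (f + g) <= Lip0_norm f + Lip0_norm g.
Proof.
apply: Lip0_norm_le => [|x y]; first by rewrite addr_ge0 ?Lip0_norm_ge0.
have E z : (f + g) z = f z + g z by [].
by rewrite !E opprD addrACA mulrDl (le_trans (ler_normD _ _))// lerD ?Lip0_normP.
Qed.

Let norm_scale_le a f : Lip0_norm (a *: f) <= `|a| * Lip0_norm f.
Proof.
apply: Lip0_norm_le => [|x y]; first by rewrite mulr_ge0 ?Lip0_norm_ge0.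
have E z : (a *: f) z = a * f z by [].
by rewrite !E -mulrBr normrM -mulrA ler_wpM2l// Lip0_normP.
Qed.

Let norm_scale a f : Lip0_norm (a *: f) = `|a| * Lip0_norm f.
Proof.
apply/eqP; rewrite eq_le norm_scale_le /=; have [->|a0] := eqVneq a 0.
  by rewrite normr0 mul0r Lip0_norm_ge0.
rewrite -ler_pdivlMl ?normr_gt0// -normfV.
by rewrite -[in leLHS](scalerK a0 f) norm_scale_le.
Qed.

Let norm_eq0 f : Lip0_norm f = 0 -> f = 0.
Proof.
move=> f0; apply/val_inj/funext => x /=.
have := Lip0_funP f; rewrite inE /= => -[fO _].
have := Lip0_normP f x O; rewrite f0 mul0r fO subr0 normr_le0 => /eqP ->.
by [].
Qed.

HB.instance Definition _ :=
  Lmodule_isNormed.Build R Lip0 norm_triangle norm_scale norm_eq0.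

End Lip0.

Section linfty.
Variable R : realType.

Definition linfty_pred : {pred nat -> R} := mem [set u | bounded_fun u].

Record linfty := Linfty {
  linfty_seq :> nat -> R ;
  linfty_seqP : linfty_seq \in linfty_pred
}.

HB.instance Definition _ := [isSub for linfty_seq].
HB.instance Definition _ := [Choice of linfty by <:].

Lemma linfty_predP (u : nat -> R) :
  u \in linfty_pred <-> exists M, forall i, `|u i| <= M.
Proof.
have PF : ProperFilter (globally [set: nat]).
  exact: (@globally_properfilter _ _ 0%N).
rewrite inE /=; split=> [/ex_bound[M hM]|[M hM]].
  by exists M => i; exact: hM.
by apply/ex_bound; exists M => i _; exact: hM.
Qed.

Lemma linfty_submod_closed : submod_closed linfty_pred.
Proof.
split=> [|a u v]; first by apply/linfty_predP; exists 0 => i; rewrite normr0.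
move=> /linfty_predP[M hM] /linfty_predP[N hN].
apply/linfty_predP; exists (`|a| * M + N) => i; rewrite !fctE.
by rewrite (le_trans (ler_normD _ _))// lerD// normrZ ler_wpM2l.
Qed.

HB.instance Definition _ :=
  GRing.isSubmodClosed.Build _ _ linfty_pred linfty_submod_closed.
HB.instance Definition _ := [SubChoice_isSubLmodule of linfty by <:].

Implicit Types u v : linfty.

Definition linfty_norm u : R := sup (range (fun i => `|u i|)).

Lemma linfty_norm_ub u i : `|u i| <= linfty_norm u.
Proof.
have /linfty_predP[M hM] := linfty_seqP u.
by apply: ub_le_sup; [exists M => _ [j _ <-]; exact: hM | exists i].
Qed.

Lemma linfty_norm_le u M : (forall i, `|u i| <= M) -> linfty_norm u <= M.
Proof.
move=> hM; apply: ge_sup; first by exists `|u 0%N|, 0%N.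
by move=> _ [i _ <-]; exact: hM.
Qed.

Let norm_triangle u v : linfty_norm (u + v) <= linfty_norm u + linfty_norm v.
Proof.
apply: linfty_norm_le => i.
have -> : (u + v) i = u i + v i by [].
by rewrite (le_trans (ler_normD _ _))// lerD ?linfty_norm_ub.
Qed.

Let norm_scale_le a u : linfty_norm (a *: u) <= `|a| * linfty_norm u.
Proof.
apply: linfty_norm_le => i; have -> : (a *: u) i = a * u i by [].
by rewrite normrM ler_wpM2l// linfty_norm_ub.
Qed.

Let norm_scale a u : linfty_norm (a *: u) = `|a| * linfty_norm u.
Proof.
apply/eqP; rewrite eq_le norm_scale_le /=; have [->|a0] := eqVneq a 0.
  by rewrite normr0 mul0r (le_trans (normr_ge0 _) (linfty_norm_ub _ 0%N)).
rewrite -ler_pdivlMl ?normr_gt0// -normfV.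
by rewrite -[in leLHS](scalerK a0 u) norm_scale_le.
Qed.

Let norm_eq0 u : linfty_norm u = 0 -> u = 0.
Proof.
move=> u0; apply/val_inj/funext => i /=; apply/eqP.
by rewrite -normr_le0 -u0 linfty_norm_ub.
Qed.

HB.instance Definition _ :=
  Lmodule_isNormed.Build R linfty norm_triangle norm_scale norm_eq0.

End linfty.

Section projection_constant.
Variable R : realType.

Definition opnorm (V W : normedModType R) (f : V -> W) : R :=
  sup [set `|f x| | x in [set x | `|x| <= 1]].

Definition is_projection_onto (V : normedModType R) (V1 : set V)
    (P : {linear V -> V}) : Prop :=
  [/\ exists C : R, forall x, `|P x| <= C * `|x|,
      forall x, P (P x) = P x
    & range P = V1].

Definition isometric_copy (X V : normedModType R) (V1 : set V) : Prop :=
  exists T : {linear X -> V}, (forall x, `|T x| = `|x|) /\ range T = V1.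

(* The infimum is +oo if there is no bounded projection onto [V1]. *)
Definition inf_norm_projections (V : normedModType R) (V1 : set V) : \bar R :=
  ereal_inf [set (opnorm P)%:E | P in is_projection_onto V1].

(* lambda(X) = c. The value must be the same for every isometric copy of [X]
   in l_oo, and the first conjunct prevents this from being vacuous. *)
Definition has_projection_constant (X : normedModType R) (c : R) : Prop :=
  (exists X1 : set (linfty R), isometric_copy X X1) /\
  (forall X1 : set (linfty R), isometric_copy X X1 ->
    inf_norm_projections X1 = c%:E).

End projection_constant.

(* Main.v *)
From HB Require Import structures.
Require Import Defs.
From mathcomp Require Import all_boot all_order all_algebra.
From mathcomp Require Import all_classical all_reals ereal topology normedtype.
From mathcomp Require Import ring lra.
Set Implicit Arguments.
Unset Strict Implicit.
Unset Printing Implicit Defensive.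
Import Order.TTheory GRing.Theory Num.Theory.
Import numFieldNormedType.Exports.
Local Open Scope classical_set_scope.
Local Open Scope ring_scope.

(* Taking increments along the edges embeds Lip_0(G) isometrically in R^E with
   the sup norm, as the space of gradients. For G = D_{n,k} the orthogonal
   projection p_n of R^E onto the gradients satisfies
     p_{n+1}((e,i,b), (f,j,c)) = p_n(e,f)/(2k) + [(e,i) = (f,j)] (-1)^(b+c)/2,
   so it has a constant diagonal d_n and rows of constant l_1 norm c_n, with
   d_{n+1} = d_n/(2k) + 1/2 and c_{n+1} = c_n + 1 - d_n/k.
   Its sign matrix S maps gradients to gradients, and therefore tr(S Q) has the
   same value |E| c_n for every projection Q onto the gradients; as the entries
   of S are bounded by 1, tr(S Q) <= |E| ||Q||, so p_n is minimal. Hahn-Banach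
   transfers this from R^E to l_oo. *)

(** * Gradients on edges and certificates of minimality *)

Section gradient.
Variables (R : realType) (G : graph).

Definition grad (phi : G -> R) (e : edge G) : R := phi (tgt e) - phi (src e).

(** [cert_range] and [cert_id] make [p] the matrix of a projection onto the gradients; its operator
    norm for the sup norm is the row sum [c]. Where [p e f = 0], [cert_sign] leaves [S e f] free in
    [-1, 1]. The diagonal value [d] is recorded because it governs the growth of [c] under edge
    replacement. *)
Record sign_certificate (p S : edge G -> edge G -> R) (d c : R) : Prop :=
  SignCertificate {
  cert_range : forall f, exists psi, forall e, p e f = grad psi e ;
  cert_id : forall phi e, \sum_f p e f * grad phi f = grad phi e ;
  cert_diag : forall e, p e e = d /\ S e e = 1 ;
  cert_norm : forall e, \sum_f `|p e f| = c ;
  cert_sign : forall e f, `|S e f| <= 1 /\ S e f * p e f = `|p e f| ;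
  cert_sym : forall e f, S e f = S f e ;
  cert_stable : forall phi, exists psi,
    forall e, \sum_f S e f * grad phi f = grad psi e
}.

End gradient.

(** * Edge replacement: refining the projection and its signs *)

Section replace_edges.
Variables (R : realType) (k : nat) (G : graph).
Hypothesis k_gt0 : (0 < k)%N.
Local Notation H := (replace_edges k G).

Lemma sum_replace_edges (F : edge H -> R) :
  \sum_a F a = \sum_e \sum_(i < k) (F (e, i, true) + F (e, i, false)).
Proof.
transitivity (\sum_x \sum_b F (x, b)).
  by rewrite pair_bigA; under [RHS]eq_bigr do rewrite -surjective_pairing.
by rewrite [RHS]pair_bigA /=; apply: eq_bigr => -[e i] _; rewrite big_bool.
Qed.

Definition bsign (b c : bool) : R := if b == c then 1 else - 1.

(** The first term projects onto the gradients of [G] copied to all [2k] halves over each edge, the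
    second onto the functions with opposite values on the two halves of each path. The gradients of
    the new graph are the direct sum of these two spaces. *)
Definition refine_proj (p : edge G -> edge G -> R) (a b : edge H) : R :=
  p a.1.1 b.1.1 / (2 * k%:R) + (a.1 == b.1)%:R * (bsign a.2 b.2 / 2).

(** For [d] in [0, 1], the term [bsign / 2] dominates [d / (2k)] within a path, so there the
    diagonal entry 1 of [S] has to become [bsign]. *)
Definition refine_sign (S : edge G -> edge G -> R) (a b : edge H) : R :=
  S a.1.1 b.1.1 - (a.1 == b.1)%:R * (1 - bsign a.2 b.2).

Lemma sum_same_pair (F : edge G -> 'I_k -> R) (x : edge G * 'I_k) :
  \sum_e \sum_i (x == (e, i))%:R * F e i = F x.1 x.2.
Proof.
rewrite pair_bigA /= (bigD1 x) //= big1 ?addr0; last first.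
  by move=> y; rewrite -surjective_pairing eq_sym => /negbTE ->; rewrite mul0r.
by rewrite -surjective_pairing eqxx mul1r.
Qed.

Lemma grad_two_halves (phi : H -> R) e i :
  grad phi (e, i, true) + grad phi (e, i, false) =
  grad (fun v : G => phi (inl v)) e.
Proof. by rewrite /grad /=; ring. Qed.

Lemma sum_same_path (F : edge H -> R) (a : edge H) :
  \sum_(b : edge H) (a.1 == b.1)%:R * F b = F (a.1, true) + F (a.1, false).
Proof.
rewrite sum_replace_edges /=.
under eq_bigr do under eq_bigr do rewrite -mulrDr.
by rewrite (sum_same_pair (fun e i => F (e, i, true) + F (e, i, false)));
  rewrite -surjective_pairing.
Qed.

Lemma sum_fiber_grad (S : edge G -> edge G -> R) (phi : H -> R) (a : edge H) :
  \sum_(b : edge H) S a.1.1 b.1.1 * grad phi b =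
  k%:R * \sum_f S a.1.1 f * grad (fun v : G => phi (inl v)) f.
Proof.
rewrite sum_replace_edges mulr_sumr; apply: eq_bigr => e _ /=.
under eq_bigr do rewrite -mulrDr grad_two_halves.
by rewrite sumr_const card_ord -[LHS]mulr_natl.
Qed.

(** The midpoint of a path is a new vertex with a free potential: the first half fixes it, and the
    hypothesis then yields the second half. *)
Lemma replace_edges_gradient (g : edge H -> R) (phi : G -> R) :
  (forall e i, g (e, i, true) + g (e, i, false) = grad phi e) ->
  exists psi, forall a, g a = grad psi a.
Proof.
move=> hg; exists (fun v : H => match v with
  | inl u => phi u | inr x => phi (src x.1) + g (x, false) end).
move=> [[e i] []]; have := hg e i; rewrite /grad /=; lra.
Qed.

(** The bounds on [d] settle the signs of the entries [d / (2k) + 1 / 2] and [d / (2k) - 1 / 2]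
    within a path; every other entry is one of [p] divided by [2k]. *)
Lemma sign_certificate_replace_edges p S (d c : R) :
  0 <= d <= 1 -> sign_certificate p S d c ->
  sign_certificate (refine_proj p) (refine_sign S)
    (d / (2 * k%:R) + 1 / 2) (c + 1 - d / k%:R).
Proof.
move=> /andP[d0 d1] [hrange hid hdiag hnorm hsign hsym hstable].
have k0 : k%:R != 0 :> R by rewrite pnatr_eq0 -lt0n.
have k1 : 1 <= k%:R :> R by rewrite ler1n.
have d2 : 0 <= d / (2 * k%:R) <= 1 / 2.
  rewrite divr_ge0 ?mulr_ge0//= ler_pdivrMr; [lra|].
  by rewrite mulr_gt0// (lt_le_trans ltr01).
split.
- move=> [[f j] b]; have [psi hpsi] := hrange f.
  (* Over the two halves of a path the alternating terms cancel and [p / (2k)] is counted twice. *)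
  apply: (@replace_edges_gradient _ (fun v => psi v / k%:R)) => e i.
  rewrite /refine_proj /= hpsi /grad /bsign.
  by case: b => /=; field.
- move=> phi a; rewrite /refine_proj.
  transitivity ((2 * k%:R)^-1 * \sum_b p a.1.1 b.1.1 * grad phi b +
    2^-1 * \sum_b (a.1 == b.1)%:R * (bsign a.2 b.2 * grad phi b)).
    rewrite !mulr_sumr -big_split; apply: eq_bigr => b _ /=.
    by field.
  (* The first sum contributes half the increment over the whole path, the second half the signed
     difference of its two halves; together they restore the increment over [a]. *)
  rewrite sum_fiber_grad hid (sum_same_path (fun b => bsign a.2 b.2 * _)).
  case: a => -[e i] b; rewrite -(grad_two_halves phi e i) /bsign.
  by case: b => /=; field.
- move=> [[e i] b].
  rewrite /refine_proj /refine_sign /= !eqxx /bsign eqxx /= !mul1r.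
  by have [-> ->] := hdiag e; split=> //; rewrite subrr subr0.
- move=> [[e i] b]; rewrite sum_replace_edges.
  (* The two halves of a path contribute [2 |p e f| / (2k)], except on the path of the row itself,
     where they contribute [(1/2 + d/(2k)) + (1/2 - d/(2k)) = 1] instead of [d / k]. *)
  transitivity (\sum_f \sum_(j < k) (`|p e f| / k%:R +
    ((e, i) == (f, j))%:R * (1 - d / k%:R))).
    apply: eq_bigr => f _; apply: eq_bigr => j _; rewrite /refine_proj /=.
    case: eqP => [[<- _]|_].
      have [-> _] := hdiag e; case/andP: d2 => d2 d3; rewrite (ger0_norm d0).
      have h : d / k%:R = 2 * (d / (2 * k%:R)) by field.
      by case: b; rewrite /bsign /= ?mul1r ?h;
        [rewrite ger0_norm ?ler0_norm; lra|rewrite ler0_norm ?ger0_norm; lra].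
    rewrite !mul0r !addr0 normrM normfV (ger0_norm (_ : 0 <= 2 * k%:R)).
      by field.
    exact: mulr_ge0.
  under eq_bigr do rewrite big_split.
  rewrite big_split /= (sum_same_pair (fun _ _ => _)).
  under eq_bigr do rewrite sumr_const card_ord -[_ *+ k]mulr_natl.
  under eq_bigr do rewrite mulrC divfK//.
  by rewrite hnorm; ring.
- move=> [[e i] b] [[f j] c'] /=.
  rewrite /refine_proj /refine_sign /=; case: eqP => [[<- _]|_].
    have [-> ->] := hdiag e.
    case/andP: d2 => d2 d3.
    rewrite /bsign; case: eqP => _.
      by rewrite !mul1r subrr subr0 normr1 ger0_norm; [split; lra|lra].
    have -> : 1 - true%:R * (1 - -1) = -1 :> R by rewrite mul1r; ring.
    by rewrite normrN1 !mul1r ler0_norm; [split; lra|lra].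
  have [h1 h2] := hsign e f; rewrite !mul0r subr0 addr0; split=> //.
  by rewrite mulrA h2 normrM normfV (ger0_norm (_ : 0 <= 2 * k%:R))// mulr_ge0.
- move=> [[e i] b] [[f j] c'] /=; rewrite /refine_sign /= hsym.
  by rewrite [(f, j) == _]eq_sym /bsign [c' == b]eq_sym.
- move=> phi; have [psi hpsi] := hstable (fun v : G => phi (inl v)).
  (* The correction [1 - bsign] equals 2 on the opposite half and 0 on the same half, whence [sumS];
     adding the two rows of a path gives this potential. *)
  apply: (@replace_edges_gradient _ (fun v => 2 * k%:R * psi v - 2 * phi (inl v))).
  move=> e i.
  have sumS b : \sum_f refine_sign S (e, i, b) f * grad phi f =
      k%:R * grad psi e - 2 * grad phi (e, i, ~~ b).
    transitivity (\sum_f S e f.1.1 * grad phi f -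
      \sum_(f : edge H) ((e, i) == f.1)%:R * ((1 - bsign b f.2) * grad phi f)).
      by rewrite -sumrB; apply: eq_bigr => f _; rewrite /refine_sign; ring.
    rewrite (sum_fiber_grad S phi (e, i, b)) hpsi.
    rewrite (sum_same_path (fun f => (1 - bsign b f.2) * _) (e, i, b)) /bsign.
    by case: b => /=; ring.
  by rewrite !sumS -addrACA; rewrite /grad /=; ring.
Qed.

End replace_edges.

(** * The Hahn-Banach theorem for a seminorm *)

Section hahn_banach.
Variables (R : realType) (V : lmodType R) (p : V -> R).
Hypothesis pD : forall x y, p (x + y) <= p x + p y.
Hypothesis pZ : forall a x, p (a *: x) <= `|a| * p x.

(** Partial functionals are encoded by their graphs, so that Zorn's lemma applies to inclusion of
    sets; single-valuedness follows from domination. *)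
Let dominated_graph (G : set (V * R)) : Prop :=
  (forall a u v, G u -> G v -> G (a *: u.1 + v.1, a * u.2 + v.2)) /\
  (forall u, G u -> u.2 <= p u.1).

Let graph_scale G a u : dominated_graph G -> G (0, 0) -> G u ->
  G (a *: u.1, a * u.2).
Proof. by move=> [lG _] G0 /(lG a _ _)/(_ G0); rewrite !addr0. Qed.

Let graph_unique G x r s : dominated_graph G -> G (x, r) -> G (x, s) -> r = s.
Proof.
move=> [lG dG] Gr Gs.
have p0 : p 0 <= 0 by have := pZ 0 0; rewrite scale0r normr0 mul0r.
have := dG _ (lG (-1) _ _ Gr Gs); have := dG _ (lG (-1) _ _ Gs Gr).
by rewrite /= !scaleN1r !addNr => h1 h2; lra.
Qed.

(** The value at [x] must lie above every [u.2 - p (u.1 - x)] and below every [p (v.1 + x) - v.2].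
    Subadditivity makes these bounds compatible, and the supremum of the lower ones is chosen. *)
Let extend_graph G x : dominated_graph G -> G (0, 0) ->
  exists c, dominated_graph [set u | exists v a, [/\ G v,
    u.1 = v.1 + a *: x & u.2 = v.2 + a * c]].
Proof.
move=> GG G0; have [lG dG] := GG.
pose A := [set v.2 - p (v.1 - x) | v in G].
have bound u v : G u -> G v -> u.2 - p (u.1 - x) <= p (v.1 + x) - v.2.
  move=> Gu Gv; have := dG _ (lG 1 _ _ Gu Gv); rewrite /= scale1r mul1r.
  have -> : u.1 + v.1 = (u.1 - x) + (v.1 + x) by rewrite addrACA addNr addr0.
  by move=> h; have := pD (u.1 - x) (v.1 + x); lra.
have A0 : A !=set0 by exists (0 - p (0 - x)); exists (0, 0).
have hl u : G u -> u.2 - p (u.1 - x) <= sup A.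
  move=> Gu; apply: ub_le_sup; last by exists u.
  by exists (p (0 + x) - 0) => _ [v Gv <-]; exact: (bound v (0, 0)).
have hr v : G v -> sup A <= p (v.1 + x) - v.2.
  by move=> Gv; apply: ge_sup => // _ [u Gu <-]; exact: bound.
exists (sup A); split=> [b _ _ [u [s [Gu /= -> ->]]] [v [t [Gv /= -> ->]]]|].
  exists (b *: u.1 + v.1, b * u.2 + v.2), (b * s + t); split=> /=.
  - exact: lG.
  - by rewrite scalerDr scalerDl scalerA addrACA.
  - by ring.
move=> w [v [a [Gv -> ->]]].
(* Dividing by the modulus of [a] reduces to the coefficients -1 and 1, covered by [hl] and [hr]. *)
have [a0|a0|->] := ltgtP a 0; last by rewrite scale0r mul0r !addr0; exact: dG.
- have := hl _ (graph_scale (- a^-1) GG G0 Gv) => /=.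
  have -> : - a^-1 *: v.1 - x = - a^-1 *: (v.1 + a *: x).
    by rewrite scalerDr scalerA mulNr mulVf ?lt_eqF// scaleN1r.
  have := pZ (- a^-1) (v.1 + a *: x).
  rewrite ger0_norm ?oppr_ge0 ?invr_le0 ?(ltW a0)// => h' h.
  have : (- a) * (- a^-1 * v.2 - - a^-1 * p (v.1 + a *: x)) <= - a * sup A.
    by rewrite ler_pM2l ?oppr_gt0//; lra.
  rewrite mulrBr !mulrA mulrNN divff ?lt_eqF// !mul1r => h1; lra.
- have := hr _ (graph_scale a^-1 GG G0 Gv) => /=.
  have -> : a^-1 *: v.1 + x = a^-1 *: (v.1 + a *: x).
    by rewrite scalerDr scalerA mulVf ?gt_eqF// scale1r.
  have := pZ a^-1 (v.1 + a *: x).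
  rewrite ger0_norm ?invr_ge0 ?(ltW a0)// => h' h.
  have : a * sup A <= a * (a^-1 * p (v.1 + a *: x) - a^-1 * v.2).
    by rewrite ler_pM2l//; lra.
  rewrite mulrBr !mulrA divff ?gt_eqF// !mul1r => h1; lra.
Qed.

(** The subspace is given as the image of [i], which may have a kernel: domination forces [f] to
    vanish on it. *)
Lemma hahn_banach (X : lmodType R) (i : {linear X -> V})
    (f : {linear X -> R^o}) :
  (forall x, f x <= p (i x)) ->
  exists phi : {linear V -> R^o},
    (forall x, phi (i x) = f x) /\ (forall v, `|phi v| <= p v).
Proof.
move=> fp; pose G0 : set (V * R) := range (fun x => (i x, f x)).
have G00 : G0 (0, 0) by exists 0 => //; rewrite !linear0.
(* Adding G0 inside the predicate makes it hold for the empty chain. *)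
have [F FP Ftot|A [AP Amax]] :=
  @Zorn_bigcup _ (fun A => dominated_graph (G0 `|` A)).
  (* Two points of the union of a chain already lie in one member, or in [G0] alone, and linearity
     is checked there. *)
  have joint u v : (G0 `|` \bigcup_(X in F) X) u ->
      (G0 `|` \bigcup_(X in F) X) v ->
      exists B, [/\ B `<=` \bigcup_(X in F) X, dominated_graph (G0 `|` B),
        (G0 `|` B) u & (G0 `|` B) v].
    have dom0 : dominated_graph (G0 `|` set0).
      rewrite setU0; split; last by move=> _ [x _ <-]; exact: fp.
      move=> a _ _ [x _ <-] [y _ <-].
      by exists (a *: x + y) => //; rewrite !linearP.
    move=> [Gu|[B FB Bu]] [Gv|[C FC Cv]].
    - by exists set0; split=> //; left.
    - exists C; split; [exact: bigcup_sup|exact: FP|by left|by right].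
    - exists B; split; [exact: bigcup_sup|exact: FP|by right|by left].
    - have [BC|CB] := Ftot _ _ FB FC.
      + exists C; split;
          [exact: bigcup_sup|exact: FP|right; exact: BC|by right].
      + exists B; split;
          [exact: bigcup_sup|exact: FP|by right|right; exact: CB].
  split=> [a u v hu hv|u hu].
    have [B [BF [lB _] Bu Bv]] := joint u v hu hv.
    by have [?|/BF ?] := lB a _ _ Bu Bv; [left|right].
  by have [B [_ [_ dB] Bu _]] := joint u u hu hu; exact: dB.
set G := G0 `|` A in AP; have G0G : G (0, 0) by left.
(* If [x] had no value, the extension [G'] would properly contain [A], against maximality. *)
have total x : exists r, G (x, r).
  have [c hc] := extend_graph x AP G0G.
  set G' := [set u | _] in hc.
  have GG' : G `<=` G'.
    by move=> u Gu; exists u, 0; split=> //; rewrite ?scale0r ?mul0r addr0.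
  exists c; apply: contrapT => nG; apply: (Amax G').
    split=> [u Au|G'A]; first by apply: GG'; right.
    by apply: nG; right; apply: G'A; exists (0, 0), 1; split=> //=;
      rewrite ?scale1r ?mul1r add0r.
  rewrite setUidr// => u Gu; apply: GG'; by left.
pose phi x : R^o := sval (cid (total x)).
have phiG x : G (x, phi x) by rewrite /phi; case: cid.
have phi_lin : linear phi.
  move=> a x y; apply: (graph_unique AP (phiG _)).
  by have [lG _] := AP; exact: (lG a _ _ (phiG x) (phiG y)).
pose phiL := GRing.isLinear.Build R V R^o _ phi phi_lin.
pose phi' : {linear V -> R^o} := HB.pack phi phiL.
exists phi'; split=> [x|v].
  by apply: (graph_unique AP (phiG _)); left; exists x.
have le_phi x : phi x <= p x by have [_ dG] := AP; exact: (dG _ (phiG x)).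
rewrite ler_norml le_phi andbT.
rewrite lerNl -[- phi v](linearN phi'); apply: le_trans (le_phi _) _.
by have := pZ (-1) v; rewrite scaleN1r normrN1 mul1r.
Qed.

End hahn_banach.

(** Trace duality: [pQ = Q] because [p] fixes the gradient columns of [Q], and [QSp = Sp] because
    the columns of [Sp] are gradients by [cert_stable]. Hence tr(SQ) = tr(SpQ) = tr(QSp) = tr(Sp),
    the sum of all [|p e f|]. *)
Lemma trace_sign_certificate (R : realType) (G : graph)
    (p S Q : edge G -> edge G -> R) (d c : R) :
  sign_certificate p S d c ->
  (forall f, exists psi, forall e, Q e f = grad psi e) ->
  (forall phi e, \sum_f Q e f * grad phi f = grad phi e) ->
  \sum_e \sum_f S e f * Q e f = \sum_(e : edge G) c.
Proof.
move=> [prange pid _ pnorm psign Ssym Sstable] Qrange Qid.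
have pQ e f : Q e f = \sum_g p e g * Q g f.
  have [psi hpsi] := Qrange f; rewrite hpsi -pid.
  by apply: eq_bigr => g _; rewrite hpsi.
have QSp g : \sum_f Q g f * \sum_e S f e * p e g = \sum_e S g e * p e g.
  have [phi hphi] := prange g; have [psi hpsi] := Sstable phi.
  have E f : \sum_e S f e * p e g = grad psi f.
    by rewrite -hpsi; apply: eq_bigr => e _; rewrite hphi.
  by rewrite E -Qid; apply: eq_bigr => f _; rewrite E.
transitivity (\sum_g \sum_f Q g f * \sum_e S f e * p e g).
  under eq_bigr do under eq_bigr do rewrite pQ Ssym mulr_sumr.
  under [RHS]eq_bigr do under eq_bigr do rewrite mulr_sumr.
  rewrite exchange_big [RHS]exchange_big /=; apply: eq_bigr => f _.
  rewrite exchange_big; apply: eq_bigr => g _; apply: eq_bigr => e _.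
  by rewrite mulrA mulrC.
under eq_bigr do rewrite QSp.
rewrite exchange_big; apply: eq_bigr => e _ /=.
rewrite -(pnorm e); apply: eq_bigr => f _; rewrite Ssym.
by have [_ ->] := psign e f.
Qed.

(** * The sup norm on functions on a finite set *)

Section supnorm.
Variables (R : realType) (E : finType).
Implicit Types (g h : E -> R).

Definition supnorm g : R := \big[Num.max/0]_e `|g e|.

Lemma le_supnorm g e : `|g e| <= supnorm g.
Proof. exact: le_bigmax. Qed.

Lemma supnorm_le g (L : R) :
  0 <= L -> (forall e, `|g e| <= L) -> supnorm g <= L.
Proof. by move=> L0 gL; apply: bigmax_le. Qed.

Lemma supnorm_ge0 g : 0 <= supnorm g.
Proof. exact: bigmax_ge_id. Qed.

Lemma supnormD g h : supnorm (g + h) <= supnorm g + supnorm h.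
Proof.
apply: supnorm_le => [|e]; first by rewrite addr_ge0 ?supnorm_ge0.
by rewrite (le_trans (ler_normD _ _))// lerD ?le_supnorm.
Qed.

Lemma supnormZ (a : R) g : supnorm (a *: g) <= `|a| * supnorm g.
Proof.
apply: supnorm_le => [|e]; first by rewrite mulr_ge0 ?supnorm_ge0.
by rewrite [(a *: g) e]/(a * g e) normrM ler_wpM2l ?le_supnorm.
Qed.

End supnorm.

(** * Lipschitz functions on a connected graph and their gradients *)

Section Lip0_graph.
Variables (R : realType) (G : graph) (O : graph_space R G).
Hypothesis G_connected : forall x y : G, exists l, walk l x y.
Implicit Types (f g : Lip0 O) (phi : G -> R).

Lemma walk_lipschitz phi (L : R) l x y : (forall e, `|grad phi e| <= L) ->
  walk l x y -> `|phi x - phi y| <= L * l%:R.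
Proof.
move=> hL /walkP[q [<- + <-]] {l y}; elim: q x => [|z q IH] x /=.
  by rewrite subrr normr0 mulr0.
case/andP=> /existsP[e he] hq; rewrite -(subrKA (phi z)) mulrS mulrDr mulr1.
rewrite (le_trans (ler_normD _ _))// lerD ?IH// (le_trans _ (hL e))//.
case/orP: he => /andP[/eqP hs /eqP ht]; rewrite /grad hs ht //.
by rewrite distrC.
Qed.

(** Increments telescope along a walk realising the distance, so the Lipschitz constant is
    determined on edges. *)
Lemma grad_lipschitz phi (L : R) : (forall e, `|grad phi e| <= L) ->
  lipschitz_with (X := graph_space R G) L phi.
Proof.
move=> hL x y; rewrite graph_space_mdistE; apply: walk_lipschitz => //.
by have [] := gdistP (G_connected x y).
Qed.

Lemma Lip0_norm_grad_le f (L : R) : 0 <= L -> (forall e, `|grad f e| <= L) ->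
  `|f| <= L.
Proof. by move=> L0 hL; apply: Lip0_norm_le => //; exact: grad_lipschitz. Qed.

Lemma grad_le_Lip0_norm f (e : edge G) : `|grad f e| <= `|f|.
Proof.
have := Lip0_normP f (tgt e) (src e); rewrite graph_space_mdistE.
move=> /le_trans -> //; rewrite ler_piMr ?Lip0_norm_ge0//.
rewrite lern1 gdist_le//; apply/walkP; exists [:: src e]; split=> //=.
by rewrite andbT; apply/existsP; exists e; rewrite !eqxx orbT.
Qed.

Lemma Lip0_grad_inj f g : (forall e, grad f e = grad g e) -> f = g.
Proof.
move=> fg; apply/eqP; rewrite -subr_eq0 -normr_le0.
apply: Lip0_norm_grad_le => // e.
have E (a b c d : R) : a - b - (c - d) = a - c - (b - d) by ring.
have -> : grad (f - g) e = grad f e - grad g e by exact: E.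
by rewrite fg subrr normr0.
Qed.

Lemma normalize_subproof phi :
  (fun x : graph_space R G => phi x - phi O) \in Lip0_pred O.
Proof.
rewrite inE /=; split; first exact: subrr.
exists (supnorm (grad phi)) => x y.
rewrite opprB addrA subrK; apply: grad_lipschitz => e; exact: le_supnorm.
Qed.

Definition normalize phi : Lip0 O := MkLip0 (normalize_subproof phi).

Lemma grad_normalize phi e : grad (normalize phi) e = grad phi e.
Proof. by rewrite /grad /= opprB addrA subrK. Qed.

Definition Lip0_grad f : edge G -> R := grad f.

Lemma Lip0_grad_linear : linear Lip0_grad.
Proof.
move=> a f g; apply/funext => e.
have E (b x y z t : R) :
  b * x + y - (b * z + t) = b * (x - z) + (y - t) by ring.
exact: E.
Qed.

HB.instance Definition _ :=
  GRing.isLinear.Build R (Lip0 O) (edge G -> R) _ Lip0_grad Lip0_grad_linear.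

End Lip0_graph.

(** Injectivity of l_oo: Hahn-Banach extends each coordinate, and the common bound [p] keeps the
    resulting sequences bounded. *)
Lemma linfty_extension (R : realType) (V X : lmodType R) (p : V -> R)
    (i : {linear X -> V}) (T : {linear X -> linfty R}) :
  (forall x y, p (x + y) <= p x + p y) ->
  (forall a x, p (a *: x) <= `|a| * p x) ->
  (forall x, `|T x| <= p (i x)) ->
  exists T' : {linear V -> linfty R},
    (forall x, T' (i x) = T x) /\ (forall v, `|T' v| <= p v).
Proof.
move=> pD pZ Tp.
have coord n : exists phi : {linear V -> R^o},
    (forall x, phi (i x) = T x n) /\ (forall v, `|phi v| <= p v).
  pose f x : R^o := T x n.
  have f_lin : linear f by move=> a x y; rewrite /f linearP.
  pose fL := GRing.isLinear.Build R X R^o _ f f_lin.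
  pose f' : {linear X -> R^o} := HB.pack f fL.
  apply: (hahn_banach pD pZ (f := f')) => x.
  by rewrite (le_trans (ler_norm _))// (le_trans (linfty_norm_ub _ n))// Tp.
have [phi hphi] := boolp.choice coord.
have T'_subproof v : (fun n => phi n v : R) \in @linfty_pred R.
  by apply/linfty_predP; exists (p v) => n; have [_ ->] := hphi n.
pose T' v : linfty R := Linfty (T'_subproof v).
have T'_lin : linear T'.
  by move=> a u v; apply/val_inj/funext => n /=; rewrite linearP.
pose T'L := GRing.isLinear.Build R V (linfty R) _ T' T'_lin.
pose T'' : {linear V -> linfty R} := HB.pack T' T'L.
exists T''; split=> [x|v].
  by apply/val_inj/funext => n /=; have [-> _] := hphi n.
by apply: linfty_norm_le => n; have [_ ->] := hphi n.
Qed.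

Lemma opnorm_le (R : realType) (V W : normedModType R) (f : V -> W) c :
  0 <= c -> (forall x, `|f x| <= c * `|x|) -> opnorm f <= c.
Proof.
move=> c0 fc; apply: ge_sup; first by exists `|f 0|, 0 => //=; rewrite normr0.
by move=> _ [x /= x1 <-]; rewrite (le_trans (fc x))// ler_piMr.
Qed.

(** The constant [C] makes the set under the supremum bounded, so that [sup] is a genuine upper
    bound. *)
Lemma le_opnorm (R : realType) (V W : normedModType R) (f : V -> W) C x :
  (forall x, `|f x| <= C * `|x|) -> `|x| <= 1 -> `|f x| <= opnorm f.
Proof.
move=> fC x1; apply: ub_le_sup; last by exists x.
exists `|C| => _ [y /= y1 <-]; rewrite (le_trans (fC y))//.
by rewrite (le_trans (ler_wpM2r _ (ler_norm C)))// ler_piMr.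
Qed.

(** * Upper and lower bounds for projections onto copies of Lip_0 *)

Section Lip0_projections.
Variables (R : realType) (G : graph) (O : graph_space R G).
Hypothesis G_connected : forall x y : G, exists l, walk l x y.
Variables (p S : edge G -> edge G -> R) (d c : R).
Hypothesis pS : sign_certificate p S d c.
Variable e0 : edge G.

Let c_ge0 : 0 <= c.
Proof. by rewrite -(cert_norm pS e0) sumr_ge0. Qed.

Lemma Lip0_isometric_copy :
  exists X1 : set (linfty R), isometric_copy (Lip0 O) X1.
Proof.
(* Past the end of the enumeration [nth] returns [e0], so the tail only repeats one increment and
   the supremum is unchanged. *)
pose s (f : Lip0 O) (n : nat) := grad f (nth e0 (enum (edge G)) n).
have s_subproof f : s f \in @linfty_pred R.
  by apply/linfty_predP; exists `|f| => n; exact: grad_le_Lip0_norm.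
pose T f : linfty R := Linfty (s_subproof f).
have T_lin : linear T.
  move=> a f g; apply/val_inj/funext => n /=.
  by rewrite /s -!/(Lip0_grad _ _) linearP.
pose TL := GRing.isLinear.Build R (Lip0 O) (linfty R) _ T T_lin.
pose T' : {linear Lip0 O -> linfty R} := HB.pack T TL.
exists (range T'), T'; split=> // f.
apply/eqP; rewrite eq_le; apply/andP; split.
  by apply: linfty_norm_le => n; exact: grad_le_Lip0_norm.
apply: Lip0_norm_grad_le => // e.
have := linfty_norm_ub (T' f) (index e (enum (edge G))).
by rewrite /= /s nth_index// mem_enum.
Qed.

(** The edge increments extend to functionals of norm at most 1 on l_oo; [p] turns their values into
    a gradient, at the cost of a factor [c], and [T] carries the function with this gradient back to
    l_oo. *)
Lemma Lip0_projection_exists (T : {linear Lip0 O -> linfty R}) :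
  (forall f, `|T f| = `|f|) ->
  exists P : {linear linfty R -> linfty R},
    is_projection_onto (range T) P /\ opnorm P <= c.
Proof.
move=> Tnorm.
have coord e : exists phi : {linear linfty R -> R^o},
    (forall f, phi (T f) = grad f e) /\ (forall u, `|phi u| <= `|u|).
  pose g f : R^o := grad (R := R) f e.
  have g_lin : linear (fun f : Lip0 O => g f).
    by move=> a f h; rewrite /g -!/(Lip0_grad _ _) linearP.
  pose gL :=
    GRing.isLinear.Build R (Lip0 O) R^o _ (fun f : Lip0 O => g f) g_lin.
  pose g' : {linear Lip0 O -> R^o} := HB.pack (fun f : Lip0 O => g f) gL.
  apply: (hahn_banach (p := fun u : linfty R => `|u|) _ _ (f := g')).
  - exact: ler_normD.
  - by move=> a u; rewrite normrZ.
  - by move=> f; rewrite Tnorm (le_trans (ler_norm _))// grad_le_Lip0_norm.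
have [phi hphi] := boolp.choice coord.
have [q hq] := boolp.choice (cert_range pS).
pose F u : Lip0 O := \sum_f phi f u *: normalize O G_connected (q f).
have gradF u e : grad (F u) e = \sum_f p e f * phi f u.
  rewrite -/(Lip0_grad _ _) linear_sum fct_sumE; apply: eq_bigr => f _.
  by rewrite linearZ /= mulrC hq -(grad_normalize O G_connected).
have F_lin : linear F.
  move=> a u v; rewrite scaler_sumr -big_split; apply: eq_bigr => f _ /=.
  by rewrite linearP scalerDl scalerA.
pose FL := GRing.isLinear.Build R (linfty R) (Lip0 O) _ F F_lin.
pose F' : {linear linfty R -> Lip0 O} := HB.pack F FL.
have FT f : F (T f) = f.
  apply: (Lip0_grad_inj G_connected) => e; rewrite gradF -(cert_id pS).
  by apply: eq_bigr => g _; have [-> _] := hphi g.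
pose P : {linear linfty R -> linfty R} := T \o F'.
have Pc u : `|P u| <= c * `|u|.
  rewrite Tnorm; apply: Lip0_norm_grad_le => // [|e]; first exact: mulr_ge0.
  rewrite gradF (le_trans (ler_norm_sum _ _ _))// -(cert_norm pS e) mulr_suml.
  apply: ler_sum => f _; rewrite normrM ler_wpM2l//; by have [_ ->] := hphi f.
exists P; split; last exact: opnorm_le.
split; [by exists c|by move=> u; rewrite /= FT|].
apply/seteqP; split=> _ [x _ <-]; first by exists (F x).
by exists (T x); rewrite //= FT.
Qed.

(** Extending [T] to all edge functions without increasing the norm pulls [P] back to a matrix
    projection onto the gradients, to which the trace identity applies. *)
Lemma Lip0_projection_ge (T : {linear Lip0 O -> linfty R})
    (P : {linear linfty R -> linfty R}) :
  (forall f, `|T f| = `|f|) -> is_projection_onto (range T) P -> c <= opnorm P.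
Proof.
move=> Tnorm [[C PC] PP Prange].
have [T' [T'grad T'le]] : exists T' : {linear (edge G -> R) -> linfty R},
    (forall f, T' (Lip0_grad f) = T f) /\ (forall g, `|T' g| <= supnorm g).
  apply: linfty_extension => [x y|a x|f]; [exact: supnormD|exact: supnormZ|].
  rewrite Tnorm; apply: Lip0_norm_grad_le => // [|e]; first exact: supnorm_ge0.
  exact: (le_supnorm (Lip0_grad f)).
have Tinj f g : T f = T g -> f = g.
  move=> fg; apply/eqP; rewrite -subr_eq0 -normr_eq0 -Tnorm linearB fg.
  by rewrite subrr normr0.
have PT f : P (T f) = T f.
  have : range P (T f) by rewrite Prange; exists f.
  by case=> u _ <-; rewrite PP.
pose delta f : edge G -> R := fun e => (e == f)%:R.
have coef f : exists h : Lip0 O, T h = P (T' (delta f)).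
  have : range T (P (T' (delta f))) by rewrite -Prange; exists (T' (delta f)).
  by case=> h _; exists h.
(* The gradient of [h f] is column [f] of the pulled-back projection. *)
have [h hh] := boolp.choice coef.
have Th (s : edge G -> R) : T (\sum_f s f *: h f) = P (T' s).
  have {2}-> : s = \sum_f s f *: delta f.
    apply/funext => e; rewrite fct_sumE (bigD1 e)//= big1 ?addr0.
      by rewrite -[RHS]/(s e * (e == e)%:R) eqxx mulr1.
    by move=> f /negbTE fe; rewrite -[LHS]/(s f * (e == f)%:R) eq_sym fe mulr0.
  rewrite !linear_sum; apply: eq_bigr => f _.
  by rewrite !linearZ hh.
have gradh s e : grad (\sum_f s f *: h f) e = \sum_f s f * grad (h f) e.
  rewrite -/(Lip0_grad _ _) linear_sum fct_sumE; apply: eq_bigr => f _.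
  by rewrite linearZ.
have Qid phi e : \sum_f grad (h f) e * grad phi f = grad phi e.
  rewrite -(grad_normalize O G_connected phi e).
  have <- : \sum_f grad phi f *: h f = normalize O G_connected phi.
    apply: Tinj; rewrite Th -PT -T'grad; congr (P (T' _)); apply/funext => f.
    exact/esym/grad_normalize.
  by rewrite gradh; apply: eq_bigr => f _; rewrite mulrC.
have Qrange f : exists psi, forall e, grad (h f) e = grad psi e by exists (h f).
have trace := trace_sign_certificate pS Qrange Qid.
(* Row [e] of [S] has sup norm at most 1, so its image under [P \o T'] has norm at most [opnorm P];
   the inner sum is one edge increment of the corresponding function. *)
have : \sum_(e : edge G) c <= \sum_(e : edge G) opnorm P.
  rewrite -trace; apply: ler_sum => e _.
  rewrite -gradh (le_trans (ler_norm _))//.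
  rewrite (le_trans (grad_le_Lip0_norm _ _))// -Tnorm Th (le_opnorm PC)//.
  rewrite (le_trans (T'le _))// supnorm_le// => f.
  by have [] := cert_sign pS e f.
by rewrite !sumr_const ler_pMn2r//; apply/card_gt0P; exists e0.
Qed.

Lemma Lip0_projection_constant : has_projection_constant (Lip0 O) c.
Proof.
split=> [|X1 [T [Tnorm <-]]]; first exact: Lip0_isometric_copy.
apply/eqP; rewrite eq_le; apply/andP; split.
  have [P [projP Pc]] := Lip0_projection_exists Tnorm.
  by apply: ge_ereal_inf; exists (opnorm P)%:E; [exists P|rewrite lee_fin].
apply: le_ereal_inf_tmp => _ [P projP <-].
by rewrite lee_fin (Lip0_projection_ge Tnorm).
Qed.

End Lip0_projections.

(** * Certificates and projection constants of diamond graphs *)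

Lemma sign_certificate_single_edge (R : realType) :
  sign_certificate (G := single_edge) (fun _ _ => 1 : R) (fun _ _ => 1) 1 1.
Proof.
have sum1 (F : unit -> R) : \sum_(e : edge single_edge) F e = F tt.
  by rewrite (bigD1 tt)//= big1 ?addr0// => -[].
split=> //.
- by move=> _; exists (fun v : bool => v%:R) => e; rewrite /grad /= subr0.
- by move=> phi [] /=; rewrite sum1 mul1r.
- by move=> _; rewrite sum1 normr1.
- by move=> _ _; rewrite normr1 mulr1.
- by move=> phi; exists phi => -[]; rewrite sum1 mul1r.
Qed.

Definition diamond_constant (R : realType) (k n : nat) : R :=
  (2 * k%:R - 2) / (2 * k%:R - 1) * n%:R
  + (4 * k%:R ^+ 2 - 6 * k%:R + 3) / (2 * k%:R - 1) ^+ 2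
  + (2 * k%:R - 2) / (2 * k%:R - 1) ^+ 2 * (1 / (2 * k%:R) ^+ n).

(** The closed form of [d] is carried through the induction since [c] grows by [1 - d / k]. The map
    sending [d] to [d / (2k) + 1 / 2] contracts by [1 / (2k)] towards [k / (2k - 1)], starting from
    1. *)
Lemma sign_certificate_diamond (R : realType) (k n : nat) : (0 < k)%N ->
  exists p S (d : R),
    [/\ sign_certificate (G := diamond n k) p S d (diamond_constant R k n),
        0 <= d <= 1
      & d = (k%:R + (k%:R - 1) / (2 * k%:R) ^+ n) / (2 * k%:R - 1)].
Proof.
move=> k_gt0; have k0 : k%:R != 0 :> R by rewrite pnatr_eq0 -lt0n.
have k1 : 1 <= k%:R :> R by rewrite ler1n.
have k2 : 2 * k%:R - 1 != 0 :> R by rewrite gt_eqF; lra.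
elim: n => [|n [p [S [d [pS d01 dE]]]]].
  exists (fun _ _ => 1), (fun _ _ => 1), 1; split.
  - have -> : diamond_constant R k 0 = 1.
      by rewrite /diamond_constant expr0; field.
    exact: sign_certificate_single_edge.
  - by rewrite ler01 lexx.
  - by rewrite expr0; field.
have kn0 : (2 * k%:R) ^+ n != 0 :> R by rewrite expf_neq0// mulf_neq0.
have := sign_certificate_replace_edges k_gt0 d01 pS.
have -> : diamond_constant R k n + 1 - d / k%:R = diamond_constant R k n.+1.
  rewrite dE /diamond_constant -[n.+1%:R]natr1 [_ ^+ n.+1]exprS.
  move: (_ ^+ n) kn0 => x x0; field; by rewrite x0 k0 k2.
move=> H; exists (refine_proj p), (refine_sign S), (d / (2 * k%:R) + 1 / 2).
split=> //; last by rewrite dE exprS; field; rewrite kn0 k0 k2.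
case/andP: d01 => d0 d1; have k2_gt0 : 0 < 2 * k%:R :> R by lra.
have : 0 <= d / (2 * k%:R) by rewrite divr_ge0// ltW.
have : d / (2 * k%:R) <= 1 / 2 by rewrite ler_pdivrMr//; lra.
by move=> h1 h2; apply/andP; split; lra.
Qed.

Lemma diamond_edge n k : (0 < k)%N -> edge (diamond n k).
Proof.
move=> k0; elim: n => [|n e]; first exact: tt.
exact: (e, Ordinal k0, false).
Qed.

Lemma diamond_projection_constant (R : realType) (k n : nat)
    (O : graph_space R (diamond n k)) : (0 < k)%N ->
  has_projection_constant (Lip0 O) (diamond_constant R k n).
Proof.
move=> k0; have [p [S [d [pS _ _]]]] := sign_certificate_diamond R n k0.
apply: (Lip0_projection_constant _ _ pS (diamond_edge n k0)) => x y.
exact: diamond_connected.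
Qed.

Theorem theorem24 (R : realType) :
  (forall (k n : nat) (O : graph_space R (diamond n k)),
     (2 <= k)%N -> (1 <= n)%N ->
     has_projection_constant (Lip0 O)
       ((2 * k%:R - 2) / (2 * k%:R - 1) * n%:R
        + (4 * k%:R ^+ 2 - 6 * k%:R + 3) / (2 * k%:R - 1) ^+ 2
        + (2 * k%:R - 2) / (2 * k%:R - 1) ^+ 2 * (1 / (2 * k%:R) ^+ n)))
  /\
  (forall (n : nat) (O : graph_space R (diamond n 2)),
     (1 <= n)%N ->
     has_projection_constant (Lip0 O)
       (2 * n%:R / 3 + 7 / 9 + 2 / 9 * 4 ^- n)).
Proof.
split=> [k n O k2 _|n O _].
  by apply: diamond_projection_constant; exact: ltnW.
have -> : 2 * n%:R / 3 + 7 / 9 + 2 / 9 * 4 ^- n = diamond_constant R 2 n.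
  have : 4 ^+ n != 0 :> R by rewrite expf_neq0.
  rewrite /diamond_constant (_ : 2 * 2%:R = 4 :> R); last by ring.
  by move: (4 ^+ n) => x x0; field.
exact: diamond_projection_constant.
Qed.
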